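(* Let $G=1+\mathcal{A}$ be a countable discrete algebra group associated with a nil $\Bbbk$-algebra $\mathcal{A}$, and let $\Gamma=G\times G$. Then, for every ergodic measure $\mu\in\mathcal{M}_{\Gamma}^{+}(\mathcal{A}^{\circ})$, there is at least one $\vartheta\in\mathcal{A}^{\circ}$ such that $\mathrm{supp}(\mu)=\mathcal{O}^{\vartheta}$, where $\mathcal{O}^{\vartheta}=\overline{\Gamma\cdot\vartheta}$ is the closure in $\mathcal{A}^{\circ}$ of the $\Gamma$-orbit of $\vartheta$.
   Context: Let $\Bbbk$ be a countable discrete field and $\mathcal{A}$ a countable associative nil $\Bbbk$-algebra (every element is nilpotent; $\mathcal{A}$ need not be finite-dimensional). The algebra group $G=1+\mathcal{A}$ is the set of formal objects $1+a$ ($a\in\mathcal{A}$) with multiplication $(1+a)(1+b)=1+a+b+ab$, equipped with the discrete topology. $\mathcal{A}^{\circ}$ is the Pontryagin dual of the additive group of $\mathcal{A}$ (all unitary characters), with the topology of pointwise convergence (a compact abelian group). The group $\Gamma=G\times G$ acts on $\mathcal{A}^{\circ}$ by $((g,h)\cdot\vartheta)(a)=\vartheta(g^{-1}ah)$. $\mathcal{M}^{+}_{\Gamma}(\mathcal{A}^{\circ})$ is the set of $\Gamma$-invariant regular Borel probability measures on $\mathcal{A}^{\circ}$. Such a $\mu$ is ergodic if $\mu(B)\in\{0,1\}$ for every $\Gamma$-invariant Borel set $B$. The support $\mathrm{supp}(\mu)$ is the set of all $\vartheta\in\mathcal{A}^\circ$ such that $\mu(U)>0$ for every open neighbourhood $U$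 of $\vartheta$. *)

(* Defs.v *)
From HB Require Import structures.
From mathcomp Require Import all_boot all_order all_algebra complex.
From mathcomp Require Import all_classical all_reals all_analysis.

Set Implicit Arguments.
Unset Strict Implicit.
Unset Printing Implicit Defensive.

Import Order.TTheory GRing.Theory Num.Theory.
Import numFieldNormedType.Exports.

Local Open Scope classical_set_scope.
Local Open Scope ring_scope.

(* Not necessarily unital (indeed, a nonzero nil algebra never is), hence not an
   instance of the algebra structures of ssralg. The term
   [iter n (nilmul a) a] is the power a^(n+1). *)
HB.mixin Record Lmodule_isNilAlgebra (k : fieldType) A of GRing.Lmodule k A := {
  nilmul : A -> A -> A;
  nilmulA : associative nilmul;
  nilmulDl : left_distributive nilmul +%R;
  nilmulDr : right_distributive nilmul +%R;
  nilmulZl : forall (c : k) (a b : A), nilmul (c *: a) b = c *: nilmul a b;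
  nilmulZr : forall (c : k) (a b : A), nilmul a (c *: b) = c *: nilmul a b;
  nilmul_nil : forall a : A, exists n : nat, iter n (nilmul a) a = 0
}.

#[short(type="nilAlgType")]
HB.structure Definition NilAlgebra (k : fieldType) :=
  {A of Lmodule_isNilAlgebra k A & GRing.Lmodule k A}.

Local Notation "a ** b" := (nilmul a b) (at level 40, left associativity).

(* [OnePlus a] is the formal object 1 + a. *)
Record algGroup (k : fieldType) (A : nilAlgType k) : Type :=
  OnePlus { minusOne : A }.

HB.instance Definition _ (k : fieldType) (A : nilAlgType k) :=
  [isNew for @minusOne k A].
HB.instance Definition _ (k : fieldType) (A : nilAlgType k) :=
  [Choice of algGroup A by <:].

Section AlgebraGroup.
Variables (k : fieldType) (A : nilAlgType k).
Implicit Types (a b c : A) (g h : algGroup A).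

Lemma nilmul0l a : 0 ** a = 0.
Proof. by apply: (addrI (0 ** a)); rewrite -nilmulDl !addr0. Qed.

Lemma nilmul0r a : a ** 0 = 0.
Proof. by apply: (addrI (a ** 0)); rewrite -nilmulDr !addr0. Qed.

Lemma nilmulNl a b : (- a) ** b = - (a ** b).
Proof. by apply: (addrI (a ** b)); rewrite -nilmulDl !subrr nilmul0l. Qed.

Lemma nilmulNr a b : a ** (- b) = - (a ** b).
Proof. by apply: (addrI (a ** b)); rewrite -nilmulDr !subrr nilmul0r. Qed.

Lemma iter_nilmulC n a : iter n (nilmul a) a ** a = a ** iter n (nilmul a) a.
Proof. by elim: n => //= n IHn; rewrite -nilmulA IHn. Qed.

Definition algGroup_mul g h : algGroup A :=
  let a := minusOne g in let b := minusOne h in OnePlus (a + b + a ** b).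

Definition algGroup_one : algGroup A := OnePlus 0.

Fact nil_index_subproof a : exists n, iter n (nilmul a) a == 0.
Proof. by have [n an0] := nilmul_nil a; exists n; rewrite an0. Qed.

Definition nil_index a : nat := ex_minn (nil_index_subproof a).

(* (1 + a)^-1 = 1 + \sum_(i >= 1) (- a)^i, a finite sum as - a is nilpotent. *)
Definition algGroup_inv g : algGroup A :=
  let c := - minusOne g in
  OnePlus (\sum_(i < nil_index c) iter i (nilmul c) c).

Lemma geom_nill c n :
  c + c ** (\sum_(i < n) iter i (nilmul c) c) =
  \sum_(i < n) iter i (nilmul c) c + iter n (nilmul c) c.
Proof.
elim: n => [|n IHn]; first by rewrite !big_ord0 nilmul0r addr0 add0r.
by rewrite !big_ord_recr /= nilmulDr addrA IHn.
Qed.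

Lemma geom_nilr c n :
  c + (\sum_(i < n) iter i (nilmul c) c) ** c =
  \sum_(i < n) iter i (nilmul c) c + iter n (nilmul c) c.
Proof.
elim: n => [|n IHn]; first by rewrite !big_ord0 nilmul0l addr0 add0r.
by rewrite !big_ord_recr /= nilmulDl addrA IHn iter_nilmulC.
Qed.

Lemma algGroup_mulA : associative algGroup_mul.
Proof.
move=> [a] [b] [c]; congr OnePlus => /=.
rewrite !nilmulDl !nilmulDr nilmulA !addrA.
by rewrite [LHS](ACl (1*2*5*3*6*4*7)%AC).
Qed.

Lemma algGroup_mul1g : left_id algGroup_one algGroup_mul.
Proof. by case=> a; congr OnePlus; rewrite /= nilmul0l add0r addr0. Qed.

Lemma algGroup_mulg1 : right_id algGroup_one algGroup_mul.
Proof. by case=> a; congr OnePlus; rewrite /= nilmul0r !addr0. Qed.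

Lemma algGroup_mulVg : left_inverse algGroup_one algGroup_inv algGroup_mul.
Proof.
case=> a; congr OnePlus => /=; rewrite /nil_index.
case: ex_minnP => n /eqP cn0 _; have := geom_nilr (- a) n.
rewrite cn0 addr0 nilmulNr; set b := \sum_(i < n) _ => bE.
by rewrite -[X in X + a + _]bE [_ + a]addrAC addNr add0r addNr.
Qed.

Lemma algGroup_mulgV : right_inverse algGroup_one algGroup_inv algGroup_mul.
Proof.
case=> a; congr OnePlus => /=; rewrite /nil_index.
case: ex_minnP => n /eqP cn0 _; have := geom_nill (- a) n.
rewrite cn0 addr0 nilmulNl; set b := \sum_(i < n) _ => bE.
by rewrite -[X in a + X + _]bE addrA subrr add0r addNr.
Qed.

HB.instance Definition _ := isGroup.Build (algGroup A)
  algGroup_mulA algGroup_mul1g algGroup_mulg1 algGroup_mulVg algGroup_mulgV.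

(* The products (1 + a) b and b (1 + a), which lie in A. *)
Definition lact g b : A := b + minusOne g ** b.
Definition ract b g : A := b + b ** minusOne g.

Lemma lactD g b c : lact g (b + c) = lact g b + lact g c.
Proof. by rewrite /lact nilmulDr addrACA. Qed.

Lemma ractD g b c : ract (b + c) g = ract b g + ract c g.
Proof. by rewrite /ract nilmulDl addrACA. Qed.

Lemma lactM g h b : lact (g * h)%g b = lact g (lact h b).
Proof.
rewrite /lact /= !nilmulDl nilmulDr nilmulA -!addrA; congr (_ + _).
by rewrite addrCA.
Qed.

Lemma ractM b g h : ract b (g * h)%g = ract (ract b g) h.
Proof. by rewrite /ract /= !nilmulDr !nilmulDl nilmulA !addrA. Qed.

Lemma lact1 b : lact 1%g b = b.
Proof. by rewrite /lact nilmul0l addr0. Qed.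

Lemma ract1 b : ract b 1%g = b.
Proof. by rewrite /ract nilmul0r addr0. Qed.

Lemma lact_ract g b h : lact g (ract b h) = ract (lact g b) h.
Proof. by rewrite /lact /ract nilmulDr nilmulDl nilmulA addrACA. Qed.

End AlgebraGroup.

Section Dual.
Variables (R : realType) (k : fieldType) (A : nilAlgType k).

(* R[i]^o is the type of complex numbers with its norm topology. *)
Definition unitary_characters : set {ptws A -> R[i]^o} :=
  [set chi : A -> R[i] | (forall a b, chi (a + b) = chi a * chi b) /\
                         (forall a, `|chi a| = 1)].

(* The Pontryagin dual of (A, +), with the subspace topology inherited from the
   topology of pointwise convergence. *)
Definition pdual : Type := set_type unitary_characters.

HB.instance Definition _ := Topological.on pdual.

Definition dual_fun (theta : pdual) : A -> R[i] := set_val theta.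
Local Coercion dual_fun : pdual >-> Funclass.

Lemma eq_pdual (theta eta : pdual) : theta =1 eta -> theta = eta.
Proof. by move=> E; apply/val_inj/funext. Qed.

Definition mk_dual (chi : A -> R[i]) (chiP : unitary_characters chi) : pdual :=
  SigSub (mem_set chiP).

Fact trivial_character_subproof : unitary_characters (fun=> 1).
Proof. by split=> [a b|a]; rewrite ?mulr1 ?normr1. Qed.

HB.instance Definition _ :=
  isPointed.Build pdual (mk_dual trivial_character_subproof).

Definition Gamma : groupType := (algGroup A * algGroup A)%type.

Definition dual_act_fun (x : Gamma) (theta : pdual) : A -> R[i] :=
  fun a => theta (ract (lact x.1^-1%g a) x.2).

Fact dual_act_subproof (x : Gamma) (theta : pdual) :
  unitary_characters (dual_act_fun x theta).
Proof.
have [thetaD theta1] := set_mem (valP theta).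
split=> [a b|a]; last exact: theta1.
by rewrite /dual_act_fun lactD ractD; exact: thetaD.
Qed.

(* ((g, h) . theta)(a) = theta (g^-1 a h) *)
Definition dual_act (x : Gamma) (theta : pdual) : pdual :=
  mk_dual (dual_act_subproof x theta).

Lemma dual_actE (x : Gamma) (theta : pdual) (a : A) :
  dual_act x theta a = theta (ract (lact x.1^-1%g a) x.2).
Proof. by []. Qed.

Lemma dual_act1 (theta : pdual) : dual_act 1%g theta = theta.
Proof.
by apply: eq_pdual => a; rewrite dual_actE /= invg1 lact1 ract1.
Qed.

Lemma dual_actM (x y : Gamma) (theta : pdual) :
  dual_act (x * y)%g theta = dual_act x (dual_act y theta).
Proof.
apply: eq_pdual => a; rewrite !dual_actE /= invgM.
by rewrite lactM ractM lact_ract.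
Qed.

Definition dual_orbit (theta : pdual) : set pdual :=
  [set dual_act x theta | x in [set: Gamma]].

Definition dual_orbit_closure (theta : pdual) : set pdual :=
  closure (dual_orbit theta).

Definition borel_dual := g_sigma_algebraType (@open pdual).

HB.instance Definition _ := Measurable.on borel_dual.

Local Open Scope ereal_scope.

Definition regular_measure (mu : set borel_dual -> \bar R) : Prop :=
  forall B : set borel_dual, measurable B ->
    mu B = ereal_inf
      [set mu U | U in [set U : set pdual | open U /\ B `<=` U]] /\
    mu B = ereal_sup
      [set mu K | K in [set K : set pdual | compact K /\ K `<=` B]].

Definition Gamma_invariant_measure (mu : set borel_dual -> \bar R) : Prop :=
  forall (x : Gamma) (B : set borel_dual), measurable B ->
    mu (dual_act x @` B) = mu B.

Definition invariant_probabilities : set (probability borel_dual R) :=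
  [set mu | regular_measure mu /\ Gamma_invariant_measure mu].

Definition ergodic (mu : probability borel_dual R) : Prop :=
  forall B : set borel_dual, measurable B ->
    (forall x : Gamma, dual_act x @` B = B) -> mu B = 0 \/ mu B = 1.

Definition msupport (mu : probability borel_dual R) : set pdual :=
  [set theta | forall U : set pdual, open U -> U theta -> 0 < mu U].

End Dual.

Arguments unitary_characters R {k} A.
Arguments pdual R {k} A.
Arguments borel_dual R {k} A.
Arguments Gamma {k} A.
Arguments invariant_probabilities R {k} A.

(* Main.v *)
(* As the algebra is countable, its dual is second countable. For a basic open
   set U of positive measure, the union of the translates of U is open and
   invariant, so it has measure 1 by ergodicity. Hence almost every theta avoids
   all null basic open sets, that is, lies in the support, and has an orbit
   meeting every non-null basic open set, that is, dense in the support. The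
   support being closed and invariant, it is the closure of that orbit. *)

Require Import Defs.
From mathcomp Require Import all_boot all_order all_algebra complex finmap lra.
From mathcomp Require Import all_classical all_reals all_analysis.

Set Implicit Arguments.
Unset Strict Implicit.
Unset Printing Implicit Defensive.

Import Order.TTheory GRing.Theory Num.Theory.
Import numFieldNormedType.Exports.

Local Open Scope classical_set_scope.
Local Open Scope ring_scope.

Lemma second_countable_initial (S : choiceType) (T : topologicalType)
    (f : S -> T) :
  @second_countable T -> @second_countable (initial_topology f).
Proof.
case=> B cB [Bop Bbase]; exists [set f @^-1` b | b in B].
  exact: card_le_trans (card_image_le _ _) cB.
split=> [_ [b Bb <-]|x V [_ [[W Wop <-] Wfx] WV]].
  by exists b => //; exact: Bop.
have [b [Bb bfx] bW] := Bbase (f x) W (open_nbhs_nbhs (conj Wop Wfx)).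
by exists (f @^-1` b); [split=> //; exists b|move=> y by_; exact/WV/bW].
Qed.

(** Finite intersections of members of the given bases form a base of the supremum, and a countable
    set has only countably many finite subsets. *)
Lemma second_countable_sup (T : choiceType) (I : Type)
    (Tc : I -> Topological T) :
  countable [set: I] ->
  (forall i, @second_countable (Topological.Pack (Tc i))) ->
  @second_countable (sup_topology Tc).
Proof.
move=> cI cT; have /all_sig2[B cB Bbase] := fun i => cid2 (cT i).
pose D : set (set T) := \bigcup_i (B i : set (set T)).
have cD : countable D by apply: bigcup_countable => // i _; exact: cB.
exists (finI_from D id); first exact: (@finI_from_countable (set T)).
split=> [_ [F FD <-]|x].
  rewrite bigcap_fset big_seq; elim/big_ind: _ => [||b bF].
  - exact: openT.
  - by move=> U V; exact: openI.
  - have /set_mem[i _ Bib] := FD _ bF.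
    exists [set b]%classic; last by rewrite bigcup_set1.
    move=> _ ->; apply: finI_from1; exists i => //.
    by have [+ _] := Bbase i; exact.
(* The base property at [x] says that this filter converges to [x]; by [cvg_sup] it can be checked
   in each topology [Tc i] separately. *)
have FF : Filter (filter_from [set U | finI_from D id U /\ U x] id).
  apply: filter_from_filter.
    exists setT; split=> //; exists fset0 => //.
    by rewrite set_fset0 bigcap_set0.
  move=> U V [DU Ux] [DV Vx]; exists (U `&` V) => //.
  by split=> //; exact: finI_fromI.
apply/cvg_sup => i V xV; have [_ /(_ x V xV)[U [BU Ux] UV]] := Bbase i.
by exists U => //; split=> //; apply: (@finI_from1 _ _ D id); exists i.
Qed.

Lemma second_countable_prod (I : Type) (T : I -> topologicalType) :
  countable [set: I] -> (forall i, @second_countable (T i)) ->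
  @second_countable (prod_topology T).
Proof.
move=> cI cT; apply: second_countable_sup => // i.
exact: second_countable_initial.
Qed.

Lemma normc_le_ReIm (R : rcfType) (z : R[i]) :
  `|z| <= (`|complex.Re z| + `|complex.Im z|)%:C%C.
Proof.
rewrite normc_def lecR -(ler_pXn2r (n := 2)) ?nnegrE ?sqrtr_ge0 ?addr_ge0//.
rewrite sqr_sqrtr ?addr_ge0 ?sqr_ge0// sqrrD !real_normK ?num_real//.
by rewrite addrAC lerDl mulrn_wge0// mulr_ge0.
Qed.

Lemma second_countable_complex (R : realType) : @second_countable R[i]^o.
Proof.
pose b (c : rat * rat * rat) : set R[i]^o :=
  ball (ratr c.1.1 +i* ratr c.1.2 : R[i]^o)%C (ratr c.2)%:C%C.
exists (range b); first exact: card_le_trans (card_image_le _ _) (countableP _).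
split=> [_ [c _ <-]|z V /nbhs_ballP[e /= e0 eV]]; first exact: ball_open.
(* The radius [e] has type [R[i]]; being positive there forces its imaginary part to vanish, so it
   is a real number [r]. *)
move: e0; rewrite ltcE /= => /andP[/eqP Ime r0].
set r := complex.Re e in r0.
have eE : e = r%:C%C by rewrite /r; case: e Ime {eV r r0} => ? ? /= ->.
(* Errors below [r / 8] in both coordinates put the rational centre within [r / 4] of [z]. A radius
   [d] between [r / 4] and [r / 2] then makes the ball contain [z] and stay within distance [r] of
   it. *)
have itvP (x : R) : exists q : rat, `|x - ratr q| < r / 8.
  have [|q] := @rat_in_itvoo R (x - r / 8) (x + r / 8); first by lra.
  by rewrite in_itv /= => /andP[? ?]; exists q; rewrite ltr_norml; lra.
have [p1 zp1] := itvP (complex.Re z).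
have [p2 zp2] := itvP (complex.Im z).
have [|d] := @rat_in_itvoo R (r / 4) (r / 2); first by lra.
rewrite in_itv /= => /andP[d1 d2].
have zc : `|z - (ratr p1 +i* ratr p2)%C| < (r / 4)%:C%C.
  apply: le_lt_trans (normc_le_ReIm _) _; rewrite ltcR.
  by case: z zp1 zp2 {eV} => ? ? /=; lra.
exists (b (p1, p2, d)).
  split; first by exists (p1, p2, d).
  by rewrite /b /ball /= distrC (lt_trans zc)// ltcR.
move=> y; rewrite /b /ball /= => cy; apply: eV; rewrite /ball /= eE.
have -> : r%:C%C = (r / 2)%:C%C + (r / 2)%:C%C by rewrite -rmorphD/= -splitr.
rewrite -[z - y](subrKA (ratr p1 +i* ratr p2)%C).
apply: le_lt_trans (ler_normD _ _) _; apply: ltrD.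
  by apply: lt_trans zc _; rewrite ltcR; lra.
by apply: lt_trans cy _; rewrite ltcR.
Qed.

(** Indexing a base by the naturals, possibly with repetitions, allows countable unions of null sets
    later. A base of a pointed space is nonempty, so it is the image of such a sequence. *)
Lemma second_countable_seq (T : ptopologicalType) :
  @second_countable T -> exists b : (set T)^nat, (forall n, open (b n)) /\
    forall x V, nbhs x V -> exists2 n, b n x & b n `<=` V.
Proof.
case=> B /pfcard_geP[B0|[b]] [Bop Bbase].
  by have [U []] := Bbase point setT filterT; rewrite B0.
exists b; split=> [n|x V /Bbase[U [BU Ux] UV]]; first exact/Bop/funS.
by have [n _ bn] := @surj _ _ _ _ b U BU; exists n; rewrite bn.
Qed.

Section DualAction.
Context {R : realType} {k : fieldType} {A : nilAlgType k}.
Implicit Types (theta : pdual R A) (x y : Gamma A).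

(** The dual is a subspace of the product of copies of the complex plane indexed by [A]. *)
Lemma second_countable_pdual :
  countable [set: A] -> @second_countable (pdual R A).
Proof.
move=> cA; apply: second_countable_initial.
apply: second_countable_prod => // _.
exact: second_countable_complex.
Qed.

Lemma dual_fun_continuous (a : A) :
  continuous (fun theta => dual_fun theta a : R[i]^o).
Proof.
move=> theta; apply: (@continuous_comp (pdual R A) {ptws A -> R[i]^o} R[i]^o
  set_val (fun f => f a)).
  exact: initial_continuous.
exact: (@proj_continuous A (fun=> R[i]^o) a).
Qed.

Lemma dual_act_continuous x : continuous (dual_act (R := R) x).
Proof.
apply: continuous_comp_initial => theta.
(* Continuity is tested at each [a], where the translated character takes the value of [theta] at
   another fixed element of [A]. *)
apply/(cvg_sup _ _ (fmap_filter _ (nbhs_filter theta))) => a; move: theta.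
apply: (@continuous_comp_initial _ _ _ (fun f : A -> R[i]^o => f a)).
exact: (@dual_fun_continuous (ract (lact x.1^-1%g a) x.2)).
Qed.

Lemma dual_actK x : cancel (dual_act (R := R) x) (dual_act x^-1%g).
Proof. by move=> theta; rewrite -dual_actM mulVg dual_act1. Qed.

Lemma dual_actVK x : cancel (dual_act (R := R) x^-1%g) (dual_act x).
Proof. by move=> theta; rewrite -dual_actM mulgV dual_act1. Qed.

(** Invariance is phrased with images, whereas continuity speaks of preimages; this passes from one
    to the other. *)
Lemma dual_act_image x (B : set (pdual R A)) :
  dual_act x @` B = dual_act x^-1%g @^-1` B.
Proof.
apply/seteqP; split=> [_ [theta Btheta <-]|theta Btheta] /=.
  by rewrite dual_actK.
by exists (dual_act x^-1%g theta) => //; exact: dual_actVK.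
Qed.

Lemma dual_act_image_open x (U : set (pdual R A)) :
  open U -> open (dual_act x @` U).
Proof.
by move=> oU; rewrite dual_act_image; apply: open_comp => // theta _;
  exact: dual_act_continuous.
Qed.

Definition saturation (U : set (pdual R A)) := \bigcup_x (dual_act x @` U).

Lemma saturation_open (U : set (pdual R A)) : open U -> open (saturation U).
Proof. by move=> oU; apply: bigcup_open => x _; exact: dual_act_image_open. Qed.

Lemma sub_saturation (U : set (pdual R A)) : U `<=` saturation U.
Proof.
by move=> theta Ut; exists 1%g => //; exists theta; rewrite ?dual_act1.
Qed.

Lemma dual_act_saturation x (U : set (pdual R A)) :
  dual_act x @` saturation U = saturation U.
Proof.
have sub y : dual_act y @` saturation U `<=` saturation U.
  move=> _ [_ [z _ [theta Ut <-]] <-]; exists (y * z)%g => //.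
  by exists theta; rewrite ?dual_actM.
(* The reverse inclusion is [sub] for the inverse of [x]. *)
apply/seteqP; split=> [|theta Utheta]; first exact: sub.
rewrite dual_act_image; apply: (sub x^-1%g).
by exists theta.
Qed.

Lemma open_borel (U : set (pdual R A)) :
  open U -> measurable (U : set (borel_dual R A)).
Proof. exact: sub_sigma_algebra. Qed.

End DualAction.

Section Support.
Context {R : realType} {k : fieldType} {A : nilAlgType k}.
Variable mu : probability (borel_dual R A) R.
Local Open Scope ereal_scope.

Lemma closed_msupport : closed (msupport mu).
Proof.
move=> theta cltheta U oU Utheta.
by have [eta [+ Ueta]] := cltheta U (open_nbhs_nbhs (conj oU Utheta)); exact.
Qed.

(** Translating a neighbourhood of [dual_act x theta] back by the inverse of [x] gives a
    neighbourhood of [theta] of the same measure. *)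
Lemma msupport_dual_act x theta : Gamma_invariant_measure mu ->
  msupport mu theta -> msupport mu (dual_act x theta).
Proof.
move=> mu_inv supp U oU Uxtheta.
rewrite -(mu_inv x^-1%g U (open_borel oU)); apply: supp.
  exact: dual_act_image_open.
by exists (dual_act x theta) => //; exact: dual_actK.
Qed.

Lemma ergodic_saturation (U : set (pdual R A)) :
  ergodic mu -> open U -> 0 < mu U -> mu (saturation U) = 1.
Proof.
move=> mu_erg oU muU.
have oS := saturation_open oU.
have [S0|//] := mu_erg (saturation U) (open_borel oS)
  (fun x => dual_act_saturation x U).
have : mu U <= mu (saturation U).
  apply: le_measure; rewrite ?inE; last exact: sub_saturation.
  - exact: open_borel.
  - exact: open_borel.
by rewrite S0 leNgt muU.
Qed.

End Support.

Theorem proposition2p6 (R : realType)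
  (k : fieldType) (k_countable : countable [set: k])
  (A : nilAlgType k) (A_countable : countable [set: A])
  (mu : probability (borel_dual R A) R)
  (mu_invariant : invariant_probabilities R A mu)
  (mu_ergodic : ergodic mu) :
  exists theta : pdual R A, msupport mu = dual_orbit_closure theta.
Proof.
have [_ mu_inv] := mu_invariant.
have [b [bop bbase]] :=
  second_countable_seq (second_countable_pdual (R := R) A_countable).
(* [N n] collects the points that are bad for [b n]: those whose orbit misses it if it has positive
   measure, and its own points if it is null. *)
pose N n : set (borel_dual R A) :=
  if (0 < mu (b n))%E then ~` saturation (b n) else b n.
have N0 n : mu.-negligible (N n).
  rewrite /N; case: ifPn => [bn_gt0|]; last first.
    rewrite -leNgt measure_le0 => /eqP bn0.
    by exists (b n); split=> //; exact: open_borel.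
  have mS := open_borel (saturation_open (bop n)).
  exists (~` saturation (b n)); split=> //; first exact: measurableC.
  by rewrite [LHS]probability_setC// ergodic_saturation// subee.
(* The bad points form a null set, which cannot be the whole space since [mu] has total mass 1. *)
have [theta thetaN] : exists theta, ~ (\bigcup_n N n) theta.
  apply: contrapT => /forallNP allN.
  have [M [mM M0 NM]] := negligible_bigcup N0.
  have MT : M = setT.
    apply/seteqP; split=> // t _.
    by apply: NM; apply: contrapT; exact: allN.
  have := probability_setT mu; rewrite -MT [LHS]M0 => /esym/eqP.
  by rewrite onee_eq0.
have theta_supp : msupport mu theta.
  move=> U oU Utheta.
  have [n bntheta bnU] := bbase _ _ (open_nbhs_nbhs (conj oU Utheta)).
  have [bn_gt0|bn_le0] := ltP 0%E (mu (b n)).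
    apply: lt_le_trans bn_gt0 _.
    by apply: le_measure; rewrite ?inE //; exact: open_borel.
  by exfalso; apply: thetaN; exists n => //; rewrite /N ltNge bn_le0.
exists theta; apply/seteqP; split=> [eta eta_supp V etaV|].
  have [n bneta bnV] := bbase _ _ etaV.
  have bn_gt0 : (0 < mu (b n))%E := eta_supp _ (bop n) bneta.
  (* A point in the support has only basic neighbourhoods of positive measure, so [theta] is a
     translate of some [xi] in [b n]; conversely [xi] lies in the orbit of [theta]. *)
  have [x _ [xi bnxi xxi]] : saturation (b n) theta.
    apply: contrapT => nSbn; apply: thetaN; exists n => //.
    by rewrite /N bn_gt0.
  exists xi; split; last exact: bnV.
  by exists x^-1%g => //; rewrite -xxi dual_actK.
rewrite [X in _ `<=` X](closure_id _).1; last exact: closed_msupport.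
by apply: closure_subset => _ [x _ <-]; exact: msupport_dual_act.
Qed.
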